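(* Let $G$ be a connected non-complete graph of order $n\geq 25$. If $C(G)$ is a linear forest and $\delta(G)\geq \frac{n-4}{5}$, then $cfc(G) = 2$.
   Context: All graphs are finite, simple and undirected; $\delta(G)$ is the minimum degree. For a graph $G$, $C(G)$ denotes the subgraph of $G$ induced by the set of cut-edges of $G$. A linear forest is a forest each of whose components is a path (an edgeless graph counts). An edge-coloring of a connected graph (adjacent edges may receive the same color) is a conflict-free connection coloring if every pair of distinct vertices is joined by a path containing at least one color used on exactly one edge of that path. The conflict-free connection number $cfc(G)$ is the smallest number of colors in a conflict-free connection coloring of $G$. *)

(* Defs.v *)
From mathcomp Require Import all_boot.

Set Implicit Arguments.
Unset Strict Implicit.
Unset Printing Implicit Defensive.

Record sgraph := SGraph {
  vertex :> finType;
  adj : rel vertex;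
  adj_sym : symmetric adj;
  adj_irr : irreflexive adj }.

Section Graphs.
Variable G : sgraph.
Implicit Types (x y u v : G) (E : {set G}) (F : {set {set G}}).

Definition connected := forall x y, connect (@adj G) x y.

Definition complete := forall x y, x != y -> adj x y.

Definition degree x := #|[set y | adj x y]|.

(* Every degree is at most #|G|, so the default value of the iterated minimum
   does not affect the result on a nonempty graph. *)
Definition min_degree := \big[minn/#|G|]_(x : G) degree x.

Definition edges : {set {set G}} :=
  [set [set p.1; p.2] | p : G * G & adj p.1 p.2].

Definition del_rel E := [rel u v | adj u v && ([set u; v] != E)].

Lemma del_sym E : symmetric (del_rel E).
Proof. by move=> u v; rewrite /= adj_sym setUC. Qed.

Lemma del_irr E : irreflexive (del_rel E).
Proof. by move=> u; rewrite /= adj_irr. Qed.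

Definition del_edge E : sgraph := SGraph (del_sym E) (del_irr E).

(* Subgraph induced by a set F of edges: its vertices are the endpoints of the
   edges in F. *)
Definition einduced_rel F : rel {x : G | x \in cover F} :=
  [rel u v | adj (val u) (val v) && ([set val u; val v] \in F)].

Lemma einduced_sym F : symmetric (@einduced_rel F).
Proof. by move=> u v; rewrite /einduced_rel /= adj_sym setUC. Qed.

Lemma einduced_irr F : irreflexive (@einduced_rel F).
Proof. by move=> u; rewrite /einduced_rel /= adj_irr. Qed.

Definition edge_induced F : sgraph :=
  SGraph (@einduced_sym F) (@einduced_irr F).

Definition forest := forall s : seq G, 2 < size s -> ~~ ucycleb (@adj G) s.

(* s lists the vertices of the component of x in order along the path. *)
Definition path_component x := exists s : seq G,
  [/\ uniq s,
      s =i connect (@adj G) x &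
      {in s &, forall u v, adj u v =
         (index v s == (index u s).+1) || (index u s == (index v s).+1)}].

Definition linear_forest := forest /\ forall x, path_component x.

(* The path visits x and then the vertices of p in order. *)
Definition is_path x y (p : seq G) :=
  [/\ path (@adj G) x p, uniq (x :: p) & last x p = y].

Definition path_edges x (p : seq G) : seq {set G} :=
  pairmap (fun u v => [set u; v]) x p.

(* A coloring is a function on all sets of vertices; only its values on
   [edges] matter. *)
Definition conflict_free_path (c : {set G} -> nat) x (p : seq G) :=
  exists k, count_mem k [seq c E | E <- path_edges x p] = 1.

Definition cfc_coloring (c : {set G} -> nat) := forall x y, x != y ->
  exists p, is_path x y p /\ conflict_free_path c x p.

Definition num_colors (c : {set G} -> nat) :=
  size (undup [seq c E | E in edges]).

(* cfc(G) = k *)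
Definition cfc_number_is k :=
  (exists c, cfc_coloring c /\ num_colors c = k) /\
  (forall c, cfc_coloring c -> k <= num_colors c).

End Graphs.

Definition num_components (G : sgraph) := n_comp (@adj G) predT.

Definition cut_edges (G : sgraph) : {set {set G}} :=
  [set E in edges G | num_components G < num_components (del_edge E)].

Definition cut_subgraph (G : sgraph) : sgraph := edge_induced (cut_edges G).

(* Main.v *)
Require Import Defs.
From mathcomp Require Import all_boot all_order all_algebra.
From mathcomp Require Import zify.

(** Since [n <= 5 delta + 4] and [delta >= 5], deleting four cut-edges would
leave five components of more than [delta] vertices each; so there are at most three
cut-edges.  As they form a linear forest, one of them, [r], can be singled out
so that the others form a matching.

In every block other than a cut-edge colour one edge red.  Two distinct vertices
of such a block are joined by a path through its red edge and by a path avoiding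
it.  Gluing along cut vertices, any two vertices of [G] are joined by a path
without red edges, and also either by a path with exactly one red edge or by a
path made of cut-edges.  Finally colour [r] red as well: for two vertices
separated by [r] the former path now has exactly one red edge; for the others
the latter path does, unless it is made of cut-edges other than [r], in which
case it is a single edge because these form a matching. *)

Set Implicit Arguments.
Unset Strict Implicit.
Unset Printing Implicit Defensive.

Lemma sum_card_swap (I J : finType) (A : {set I}) (B : {set J})
    (r : I -> J -> bool) :
  \sum_(i in A) #|[set j in B | r i j]| = \sum_(j in B) #|[set i in A | r i j]|.
Proof.
transitivity (\sum_(i in A) \sum_(j in B) (r i j : nat)).
  apply: eq_bigr => i _; rewrite -sum1_card big_mkcond [RHS]big_mkcond /=.
  by apply: eq_bigr => j _; rewrite inE; case: (j \in B); case: (r i j).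
rewrite exchange_big /=; apply: eq_bigr => j _.
rewrite -sum1_card big_mkcond [RHS]big_mkcond /=.
by apply: eq_bigr => i _; rewrite inE; case: (i \in A); case: (r i j).
Qed.

(** * Paths, their lists of edges, and bridges *)

Section Paths.
Variable G : sgraph.
Implicit Types (x y z u v w : G) (p q : seq G) (A B C : {set G}).
Implicit Types (E r : {set G}) (S R : {set {set G}}).

Lemma adj_neq u v : adj u v -> u != v.
Proof. by apply: contraTneq => ->; rewrite adj_irr. Qed.

Lemma path_edges_cat x p q :
  path_edges x (p ++ q) = path_edges x p ++ path_edges (last x p) q.
Proof. exact: pairmap_cat. Qed.

Lemma path_edgesP x p E : path (@adj G) x p -> E \in path_edges x p ->
  exists u v, [/\ adj u v, E = [set u; v], u \in x :: p & v \in x :: p].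
Proof.
elim: p x => [|y p IHp] x //= /andP[xy yp]; rewrite inE => /orP[/eqP->|Ep].
  by exists x, y; rewrite !inE !eqxx orbT.
have [u [v [uv -> up vp]]] := IHp _ yp Ep.
by exists u, v; rewrite !(in_cons x) up vp !orbT.
Qed.

Lemma path_edges_sub x p E z : E \in path_edges x p -> z \in E -> z \in x :: p.
Proof.
elim: p x => [|y p IHp] x //=; rewrite inE => /orP[/eqP->|Ep zE].
  by rewrite !inE => /orP[] ->; rewrite ?orbT.
by rewrite in_cons (IHp y Ep zE) orbT.
Qed.

Lemma path_edges_uniq x p : uniq (x :: p) -> uniq (path_edges x p).
Proof.
elim: p x => [|y p IHp] x //= /andP[xyp up]; rewrite IHp // andbT.
apply: contra xyp => Ep; apply: (path_edges_sub Ep); exact: set21.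
Qed.

Lemma size_path_edges x p : size (path_edges x p) = size p.
Proof. exact: size_pairmap. Qed.

Lemma mem_path_edges_rev x p :
  path_edges (last x p) (rev (belast x p)) =i path_edges x p.
Proof.
elim: p x => [|y p IHp] x E //=; rewrite rev_cons -cats1 path_edges_cat.
rewrite mem_cat IHp /= !inE orbC; congr (_ || _).
have -> : last (last y p) (rev (belast y p)) = y.
  by case: (p) => //= z t; rewrite rev_cons last_rcons.
by rewrite setUC.
Qed.

Lemma is_path_cat x y z p q : is_path x y p -> is_path y z q ->
  (forall w, w \in q -> w \notin x :: p) -> is_path x z (p ++ q).
Proof.
move=> [xp up <-] [yq uq lq] dis; split.
- by rewrite cat_path xp.
- rewrite -cat_cons cat_uniq up; move: uq => /= /andP[_ ->]; rewrite andbT.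
  by apply/hasPn => w /dis.
- by rewrite last_cat.
Qed.

Lemma is_path_catl x y p q : is_path x y (p ++ q) -> is_path x (last x p) p.
Proof.
case; rewrite cat_path -cat_cons cat_uniq => /andP[xp _] /andP[up _] _.
by split.
Qed.

Lemma is_path_catr x y p q : is_path x y (p ++ q) -> is_path (last x p) y q.
Proof.
case; rewrite cat_path last_cat => /andP[_ xp] up lp; split=> //.
move: up; rewrite -cat_cons lastI cat_rcons cat_uniq => /and3P[_ _ ->//].
Qed.

Lemma is_path_rev x y p : is_path x y p -> is_path y x (rev (belast x p)).
Proof.
case=> xp up <-; split.
- by rewrite rev_path; under eq_path do rewrite adj_sym.
- by rewrite -rev_rcons -lastI rev_uniq.
- by case: (p) => //= z t; rewrite rev_cons last_rcons.
Qed.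

Lemma is_path_edge x y : adj x y -> is_path x y [:: y].
Proof. by move=> xy; split; rewrite /= ?xy // inE adj_neq. Qed.

Lemma is_path_nil x : is_path x x [::]. Proof. by split. Qed.

Definition in_rel B := [rel u v | [&& adj u v, u \in B & v \in B]].

Lemma connect_in_path B x y : x \in B -> connect (in_rel B) x y ->
  exists2 p, is_path x y p & {subset x :: p <= B}.
Proof.
move=> xB /connectP[p0 p0P ->]; case/shortenP: p0P => p pP up _.
have sub : {subset x :: p <= B}.
  elim: p x {up p0} xB pP => [|z p IHp] x xB /= => [_ w|].
    by rewrite inE => /eqP->.
  case/andP=> /and3P[_ _ zB] zp w; rewrite inE => /orP[/eqP->//|].
  exact: IHp.
exists p => //; split=> //; apply: sub_path pP => u v /= /and3P[] //.
Qed.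

(** The empty set satisfies this vacuously, so it can serve as [r] when there are no cut-edges. *)
Definition bridge E :=
  forall u v, E = [set u; v] -> ~~ connect (del_rel E) u v.

Lemma path_del_edge E x p :
  path (@adj G) x p -> E \notin path_edges x p -> path (del_rel E) x p.
Proof.
elim: p x => [|y p IHp] x //= /andP[xy yp]; rewrite inE negb_or => /andP[nE Ep].
by rewrite xy eq_sym nE IHp.
Qed.

Lemma connect_del_sym E : connect_sym (del_rel E).
Proof. exact/sym_connect_sym/del_sym. Qed.

(** If [q] used [E], its parts before and after [E], joined by [p], would connect the ends of [E]
    without [E]. So a bridge lies on all paths between two given vertices or on none. *)
Lemma bridge_avoid E x y p q : bridge E -> is_path x y p -> is_path x y q ->
  E \notin path_edges x p -> E \notin path_edges x q.
Proof.
move=> brE pP qP nEp; apply/negP => Eq.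
have con s t l : is_path s t l -> E \notin path_edges s l ->
    connect (del_rel E) s t.
  by case=> sl _ <- nE; apply/connectP; exists l => //; apply: path_del_edge.
have uq : uniq (path_edges x q) by case: qP => _ /path_edges_uniq.
have : exists q1 w q2, [/\ q = q1 ++ w :: q2 & E = [set last x q1; w]].
  elim: {qP uq} q (x) Eq => //= z q IHq s; rewrite inE => /orP[/eqP->|].
    by exists [::], z, q.
  move=> /IHq[q1 [w [q2 [-> ->]]]]; exists (z :: q1), w, q2; split=> //.
case=> q1 [w [q2 [eq_q defE]]]; subst q.
have /negP[] := brE _ _ defE.
rewrite path_edges_cat cat_uniq /= -defE in uq.
move: uq => /and4P[_ /norP[nE1 _] nE2 _].
have c1 := con _ _ _ (is_path_catl qP) nE1.
have q2P : is_path w y q2.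
  by rewrite -cat_rcons in qP; have := is_path_catr qP; rewrite last_rcons.
have c2 := con _ _ _ q2P nE2.
rewrite connect_del_sym in c1; apply: connect_trans c1 _.
apply: connect_trans (con _ _ _ pP nEp) _.
by rewrite connect_del_sym.
Qed.

End Paths.

Section Blocks.
Variable G : sgraph.
Implicit Types (x y z u v w : G) (p q : seq G) (A B C : {set G}).
Implicit Types (E r : {set G}) (S R : {set {set G}}) (P : seq {set G} -> Prop).

Definition path_within A x y P :=
  exists p, [/\ is_path x y p, {subset x :: p <= A} & P (path_edges x p)].

(** * Paths through a prescribed edge of a 2-connected graph *)

Section PrescribedEdge.
Variables (A : {set G}) (a b : G).
Hypotheses (aA : a \in A) (bA : b \in A) (ab : adj a b).
Hypothesis A_conn : forall x y, x \in A -> y \in A ->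
  exists2 p, is_path x y p & {subset x :: p <= A}.
Hypothesis A_2conn : forall v x y, v \in A -> x \in A -> y \in A ->
  x != v -> y != v -> exists2 p, is_path x y p & {subset x :: p <= A :\ v}.

Let thru x y := path_within A x y (fun s => [set a; b] \in s).

(* If the path to [y] runs through [z] before the edge [ab], closing it up by
   [yz] gives a cycle containing [ab]; a path from [x] avoiding [z] reaches this
   cycle at some [w], and one of the two arcs from [w] to [z] contains [ab]. *)
Lemma path_thru_edge_step x y z :
  x \in A -> thru x y -> adj y z -> z \in A -> z != x -> thru x z.
Proof.
move=> xA [p [pP pA ep]] yz zA zx.
have [zp|zp] := boolP (z \in p); last first.
  exists (p ++ [:: z]); split.
  - apply: is_path_cat pP (is_path_edge yz) _ => w.
    by rewrite mem_seq1 => /eqP->; rewrite inE negb_or zx.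
  - by move=> w; rewrite -cat_cons mem_cat mem_seq1 => /orP[/pA|/eqP->].
  - by rewrite path_edges_cat mem_cat ep.
case/path.splitP: zp pP pA ep => p1 p2 pP pA.
rewrite path_edges_cat mem_cat last_rcons.
case/orP=> ep.
  exists (rcons p1 z); split=> //.
    by have := is_path_catl pP; rewrite last_rcons.
  by move=> w wp; apply: pA; rewrite -cat_cons mem_cat wp.
have up : uniq (x :: rcons p1 z ++ p2) by case: pP.
have p2P : is_path z y p2 by have := is_path_catr pP; rewrite last_rcons.
have yp2 : y \in p2.
  case: p2P => _ _ <-; case: (p2) ep => //= t s _; exact: mem_last.
have zp2 : z \notin p2 by case: p2P => _ /andP[].
have xp2 : x \notin p2.
  move: up; rewrite -cat_cons cat_uniq => /and3P[_ /hasPn h _].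
  by apply/negP=> /h/negP[]; rewrite inE eqxx.
have p2A : {subset p2 <= A}.
  by move=> w wp; apply: pA; rewrite -cat_cons mem_cat wp orbT.
have yA : y \in A by apply: p2A.
have yz' : y != z by apply: contraNneq zp2 => <-.
rewrite eq_sym in zx.
have [q qP qA] := A_2conn zA xA yA zx yz'.
have qy : y \in q.
  case: qP => _ _ lq; have := mem_last x q; rewrite lq inE => /orP[/eqP e|//].
  by rewrite -e yp2 in xp2.
have hq : has (mem p2) q by apply/hasP; exists y.
(* As [w] is the first vertex of [q] on [p2], the part of [q] up to [w] meets [p2] only in [w]. *)
case: (split_find hq) qP qA => w q1 q2 wp2 nq1 qP qA {hq qy}.
have wA : w \in A by apply: p2A.
have q1P : is_path x w (rcons q1 w).
  by have := is_path_catl qP; rewrite last_rcons.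
have q1A : {subset x :: rcons q1 w <= A :\ z}.
  by move=> t tq; apply: qA; rewrite -cat_cons mem_cat tq.
have q1dis t : t \in p2 -> t != w -> t \notin x :: rcons q1 w.
  move=> tp tw; rewrite inE mem_rcons inE !negb_or tw /=.
  apply/andP; split; first by apply: contraNneq xp2 => <-.
  by apply: contraNN nq1 => tq; apply/hasP; exists t.
have zq1 : z \notin x :: rcons q1 w.
  by apply/negP => /q1A; rewrite !inE eqxx.
have zw : z != w by apply: contraNneq zp2 => ->.
case/path.splitP: wp2 p2P zp2 p2A ep {nq1 yp2 xp2} q1dis pP pA up.
move=> r1 r2 rP zr rA ep dis _ _ _.
have ur : uniq (z :: rcons r1 w ++ r2) by case: rP.
rewrite path_edges_cat mem_cat last_rcons in ep.
(* If the edge is on the arc from [z] to [w], this arc is walked backwards; otherwise the edge lies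
   between [w] and [y], and the path ends with the step from [y] to [z]. *)
case/orP: ep => ep.
  have r1P : is_path z w (rcons r1 w).
    by have := is_path_catl rP; rewrite last_rcons.
  exists (rcons q1 w ++ rev (belast z (rcons r1 w))); split.
  - apply: is_path_cat q1P (is_path_rev r1P) _ => t.
    rewrite mem_rev belast_rcons inE => /orP[/eqP->//|tr].
    apply: dis; first by rewrite mem_cat mem_rcons inE tr orbT.
    apply: contraTneq tr => ->; move: ur.
    by rewrite /= cat_uniq rcons_uniq => /and3P[_ /andP[]].
  - move=> t; rewrite -cat_cons mem_cat => /orP[/q1A|].
      by rewrite inE => /andP[].
    rewrite mem_rev belast_rcons inE => /orP[/eqP->//|tr].
    by apply: rA; rewrite mem_cat mem_rcons inE tr orbT.
  - rewrite path_edges_cat mem_cat last_rcons.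
    have := mem_path_edges_rev z (rcons r1 w) [set a; b].
    by rewrite last_rcons => ->; rewrite ep orbT.
have r2P : is_path w y r2 by have := is_path_catr rP; rewrite last_rcons.
exists ((rcons q1 w ++ r2) ++ [:: z]); split.
- apply: is_path_cat (is_path_cat q1P r2P _) (is_path_edge yz) _ => t.
    move=> tr; apply: dis; first by rewrite mem_cat tr orbT.
    by apply: contraTneq tr => ->; case: r2P => _ /andP[].
  rewrite mem_seq1 => /eqP->; rewrite -cat_cons mem_cat negb_or zq1 /=.
  by apply: contraNN zr; rewrite mem_cat => ->; rewrite orbT.
- move=> t; rewrite -!cat_cons !mem_cat => /orP[/orP[/q1A|tr]|].
  + by rewrite inE => /andP[].
  + by apply: rA; rewrite mem_cat tr orbT.
  + by rewrite inE => /eqP->.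
- by rewrite !path_edges_cat !mem_cat last_rcons ep orbT.
Qed.

(** Walk from [x] to [a]. If [b] is not met, one more step leads to [b]; otherwise the walk is cut
    off at [b], which comes before [a], and continued by the edge from [b] to [a]. *)
Lemma path_thru_edge_start x :
  x \in A -> exists y, [/\ y \in A, y != x & thru x y].
Proof.
move=> xA; have [p pP pA] := A_conn xA aA.
have [bp|bp] := boolP (b \in x :: p); last first.
  exists b; split=> //; first by apply: contraNneq bp => ->; rewrite inE eqxx.
  exists (p ++ [:: b]); split.
  - by apply: is_path_cat pP (is_path_edge ab) _ => w; rewrite mem_seq1 => /eqP->.
  - by move=> w; rewrite -cat_cons mem_cat mem_seq1 => /orP[/pA|/eqP->].
  - by case: pP => _ _ e; rewrite path_edges_cat mem_cat e /= inE eqxx orbT.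
have ba : b != a by rewrite eq_sym adj_neq.
have [p1 [p2 [ep lp1]]] : exists p1 p2, p = p1 ++ p2 /\ last x p1 = b.
  move: bp; rewrite inE => /orP[/eqP->|bp]; first by exists [::], p.
  by case/path.splitP: bp => p1 p2; exists (rcons p1 b), p2; rewrite last_rcons.
have ap1 : a \notin x :: p1.
  subst p; case: pP => _ up; rewrite last_cat lp1 => lp2.
  have ap2 : a \in p2.
    by case: (p2) lp2 ba => /= [->|t s <- _]; rewrite ?eqxx ?mem_last.
  by move: up; rewrite -cat_cons cat_uniq => /and3P[_ /hasPn/(_ _ ap2)].
subst p; have p1P := is_path_catl pP; rewrite lp1 in p1P.
have ba' : adj b a by rewrite adj_sym.
exists a; split=> //; first by apply: contraNneq ap1 => ->; rewrite inE eqxx.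
exists (p1 ++ [:: a]); split.
- by apply: is_path_cat p1P (is_path_edge ba') _ => w; rewrite mem_seq1 => /eqP->.
- move=> w; rewrite -cat_cons mem_cat mem_seq1 => /orP[wp|/eqP->//].
  by apply: pA; rewrite -cat_cons mem_cat wp.
- by rewrite path_edges_cat mem_cat lp1 /= inE setUC eqxx orbT.
Qed.

(** The far end of a path through the edge is moved step by step along a path to [y]. That path has
    to avoid [x], as [path_thru_edge_step] demands. *)
Lemma path_thru_edge x y : x \in A -> y \in A -> x != y -> thru x y.
Proof.
move=> xA yA xy; have [y0 [y0A y0x t0]] := path_thru_edge_start xA.
rewrite eq_sym in xy; have [p [pP _ lp] pA] := A_2conn xA y0A yA y0x xy.
elim: p y0 {y0A y0x} t0 pP pA lp => [|z p IHp] y0 t0 /= => [_ _ <-//|].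
case/andP=> y0z zp pA; have := pA z; rewrite !inE eqxx orbT => /(_ isT)/andP[zx zA].
apply: IHp => //; first exact: path_thru_edge_step t0 y0z zA zx.
by move=> w wp; apply: pA; rewrite inE wp orbT.
Qed.

End PrescribedEdge.

(** * Colouring the blocks *)

(* The path-convex sets are the connected unions of blocks when [G] is
   connected. *)
Definition path_convex A := forall x y p,
  x \in A -> y \in A -> is_path x y p -> {subset x :: p <= A}.

Lemma path_convex_conn A x y : connected G -> path_convex A ->
  x \in A -> y \in A -> exists2 p, is_path x y p & {subset x :: p <= A}.
Proof.
move=> G_conn cvA xA yA; have /connectP[p0 p0P ly] := G_conn x y.
move: ly; case/shortenP: p0P => p pP up _ ly.
have px : is_path x y p by split.
by exists p => //; apply: cvA px.
Qed.

(** The first step into [C] starts neither in [C] nor in [B], hence at [v]. *)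
Lemma exit_cut v B C x p : (forall u w, u \in B -> w \in C -> ~~ adj u w) ->
  path (@adj G) x p -> {subset x :: p <= v |: (B :|: C)} ->
  x \notin C -> last x p \in C -> v \in x :: p.
Proof.
move=> nBC; elim: p x => [|y p IHp] x /= => [_ _ /negP//|/andP[xy yp] sub xC lC].
have [yC|yC] := boolP (y \in C); last first.
  rewrite in_cons IHp ?orbT // => w wp; apply: sub; by rewrite in_cons wp orbT.
have := sub x; rewrite in_cons eqxx => /(_ isT).
rewrite !inE (negPf xC) orbF => /orP[/eqP->|xB]; first by rewrite eqxx.
by have := nBC _ _ xB yC; rewrite xy.
Qed.

(** A path with both ends in [v |: B] that visited [C] would pass through [v] on the way in and
    again on the way out. *)
Lemma path_convex_cut v B C : [disjoint B & C] -> v \notin C ->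
  (forall u w, u \in B -> w \in C -> ~~ adj u w) ->
  path_convex (v |: (B :|: C)) -> path_convex (v |: B).
Proof.
move=> dBC vC nBC cv x y p xB yB pP.
have notC z : z \in v |: B -> z \notin C.
  by rewrite !inE => /orP[/eqP->//|/(disjointFr dBC)->].
have sub : {subset x :: p <= v |: (B :|: C)}.
  have sB : v |: B \subset v |: (B :|: C) by rewrite setUS // subsetUl.
  by apply: cv pP; apply: (subsetP sB).
move=> z zp; apply: contraT => zB.
have zC : z \in C.
  by move: (sub z zp) zB; rewrite !inE; case: (z == v); case: (z \in B).
have zx : z != x by apply: contraNneq zB => ->.
move: zp; rewrite inE (negPf zx) => /= zp.
case/path.splitP: zp pP sub => p1 p2 pP sub.
have [] := is_path_catl pP; rewrite last_rcons => p1P u1 _.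
have [] := is_path_catr pP; rewrite last_rcons => p2P u2 lp2.
have v1 : v \in x :: rcons p1 z.
  apply: (exit_cut nBC p1P) (notC _ xB) _; last by rewrite last_rcons.
  by move=> w wp; apply: sub; rewrite -cat_cons mem_cat wp.
have v2 : v \in z :: p2.
  (* The rest of the path is reversed so that it, too, ends in [C]. *)
  have := is_path_rev (And3 p2P u2 lp2) => -[rP _ lr].
  have : v \in y :: rev (belast z p2).
    apply: (exit_cut nBC rP) (notC _ yB) _; last by rewrite lr.
    move=> w; rewrite -lp2 -rev_rcons -lastI mem_rev => wp.
    apply: sub; move: wp; rewrite -cat_cons mem_cat inE => /orP[/eqP->|->].
      by rewrite inE mem_rcons inE eqxx orbT.
    by rewrite orbT.
  by rewrite -lp2 -rev_rcons -lastI mem_rev.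
have zv : v != z by apply: contraNneq vC => ->.
rewrite inE (negPf zv) /= in v2.
case: pP => _ + _; rewrite -cat_cons cat_uniq => /and3P[_ /hasPn/(_ _ v2)].
by rewrite v1.
Qed.

Lemma path_within_cat A B v x y P1 P2 P : A :&: B = [set v] ->
  (forall s t, P1 s -> P2 t -> P (s ++ t)) ->
  path_within A x v P1 -> path_within B v y P2 -> path_within (A :|: B) x y P.
Proof.
move=> AB cat [p [pP pA p1]] [q [qP qB q2]]; exists (p ++ q); split.
- apply: (is_path_cat pP qP) => w wq; apply/negP => /pA wA.
  have : w \in A :&: B by rewrite inE wA qB // inE wq orbT.
  by rewrite AB inE => /eqP wv; case: qP => _ /andP[]; rewrite -wv wq.
- move=> w; rewrite -cat_cons mem_cat in_setU => /orP[/pA->//|wq].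
  by rewrite qB ?orbT // inE wq orbT.
- by case: (pP) => _ _ e; rewrite path_edges_cat e; apply: cat.
Qed.

Lemma path_within_sub A B x y P1 P : A \subset B -> (forall s, P1 s -> P s) ->
  path_within A x y P1 -> path_within B x y P.
Proof.
move=> /subsetP AB P1P [p [pP pA p1]]; exists p; split=> //; last exact: P1P.
by move=> w /pA/AB.
Qed.

Definition count_red R := count (mem R).

(** An edge of [R2] on a path in [A] would have both ends in [A :&: B], which has at most one
    vertex; so the additional red edges do not change the count. *)
Lemma path_within_recolor A B v R1 R2 x y k : A :&: B \subset [set v] ->
  (forall E, E \in R2 -> E \subset B) ->
  path_within A x y (fun s => count_red R1 s = k) ->
  path_within A x y (fun s => count_red (R1 :|: R2) s = k).
Proof.
move=> AB R2B [p [pP pA <-]]; exists p; split=> //.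
apply: eq_in_count => E Ep; rewrite /= inE.
case E2: (E \in R2); last by rewrite orbF.
have [|u [w [uw eE up wp]]] := path_edgesP _ Ep; first by case: pP.
have EAB z : z \in x :: p -> z \in E -> z == v.
  move=> zp zE; move/subsetP/(_ z): AB; rewrite !inE; apply.
  by rewrite pA //= (subsetP (R2B _ E2)).
have eu : u == v by apply: EAB; rewrite // eE set21.
have ew : w == v by apply: EAB; rewrite // eE set22.
by move: (adj_neq uw); rewrite (eqP eu) (eqP ew) eqxx.
Qed.

(** The last alternative covers [x = y], by the empty path, and vertices joined by cut-edges only,
    which are not red before [r] is added. *)
Definition block_colored A R x y :=
  path_within A x y (fun s => count_red R s = 0) /\
  (path_within A x y (fun s => count_red R s = 1) \/
   path_within A x y (fun s => forall E, E \in s -> bridge E)).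

(** One part supplies the red edge, if either can, and the other is crossed without red; if neither
    can, both parts consist of bridges. *)
Lemma block_colored_cat A B v R x y : A :&: B = [set v] ->
  block_colored A R x v -> block_colored B R v y ->
  block_colored (A :|: B) R x y.
Proof.
move=> AB [b1 r1] [b2 r2]; split.
  by apply: path_within_cat AB _ b1 b2 => s t; rewrite /count_red count_cat => -> ->.
case: r1 => r1.
  left; apply: path_within_cat AB _ r1 b2 => s t.
  by rewrite /count_red count_cat => -> ->.
case: r2 => r2.
  left; apply: path_within_cat AB _ b1 r2 => s t.
  by rewrite /count_red count_cat => -> ->.
right; apply: path_within_cat AB _ r1 r2 => s t s1 t1 E.
by rewrite mem_cat => /orP[/s1|/t1].
Qed.

Lemma block_colored_recolor A B v R1 R2 x y : A :&: B \subset [set v] ->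
  (forall E, E \in R2 -> E \subset B) ->
  block_colored A R1 x y -> block_colored A (R1 :|: R2) x y.
Proof.
move=> AB R2B [b r]; split; first exact: path_within_recolor AB R2B b.
by case: r => r; [left; apply: path_within_recolor AB R2B r | right].
Qed.

Lemma block_colored_sub A B R x y : A \subset B ->
  block_colored A R x y -> block_colored B R x y.
Proof.
move=> AB [b r]; split; first exact: path_within_sub AB _ b.
by case: r => r; [left|right]; apply: path_within_sub AB _ r.
Qed.

(** Either [A] has at most one vertex, or it consists of the two ends of a bridge, or it has at
    least three vertices and any one of its edges may be made red. *)
Lemma block_coloring_2connected A : connected G -> path_convex A ->
  (forall v x y, v \in A -> x \in A -> y \in A -> x != v -> y != v ->
     exists2 p, is_path x y p & {subset x :: p <= A :\ v}) ->
  exists R, (forall E, E \in R -> E \subset A) /\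
            {in A &, forall x y, block_colored A R x y}.
Proof.
move=> G_conn cvA A2.
have nilA R x : x \in A -> block_colored A R x x.
  have := is_path_nil x => xx xA.
  have sx : {subset [:: x] <= A} by move=> z; rewrite inE => /eqP->.
  by split; [exists [::]|right; exists [::]].
have [/existsP[a /existsP[b /and3P[aA bA ab]]]|noE] :=
    boolP [exists a, exists b, [&& a \in A, b \in A & adj a b]]; last first.
  exists set0; split=> [E|x y xA yA]; first by rewrite inE.
  have [->|xy] := eqVneq x y; first exact: nilA.
  have [[|z p] [xp _ lp] pA] := path_convex_conn G_conn cvA xA yA.
    by case/eqP: xy.
  case/existsP: noE; exists x; apply/existsP; exists z; rewrite xA.
  by case/andP: xp => -> _; rewrite pA // !inE eqxx orbT.
have Asub : {subset [:: a; b] <= A}.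
  by move=> z; rewrite !inE => /orP[]/eqP->.
have abE s t : s \in [:: a; b] -> t \in [:: a; b] -> s != t ->
    [set s; t] = [set a; b] /\ adj s t.
  rewrite !inE => /orP[]/eqP-> /orP[]/eqP->; rewrite ?eqxx // => _.
  by rewrite setUC adj_sym.
have [/existsP[c /and3P[cA ca cb]]|noc] :=
    boolP [exists c, [&& c \in A, c != a & c != b]]; last first.
  have Aab z : z \in A -> z \in [:: a; b].
    move=> zA; rewrite !inE; apply: contraR noc; rewrite negb_or => zab.
    by apply/existsP; exists z; rewrite zA.
  exists set0; split=> [E|x y xA yA]; first by rewrite inE.
  have [->|xy] := eqVneq x y; first exact: nilA.
  have [exy adxy] := abE x y (Aab x xA) (Aab y yA) xy.
  have sxy : {subset [:: x; y] <= A} by move=> z; rewrite !inE => /orP[]/eqP->.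
  split; [|right]; exists [:: y]; split=> //; try exact: is_path_edge.
    by rewrite /count_red /= inE.
  (* A path joining the ends without this edge would stay in [A] by convexity; having only [a] and
     [b] at its disposal, it would start with the very edge it avoids. *)
  move=> E; rewrite mem_seq1 => /eqP-> u v euv; apply/negP => /connectP[p0 p0P ev].
  have [uA vA] : u \in A /\ v \in A.
    by split; apply: Asub; rewrite !inE -in_set2 -exy euv ?set21 ?set22.
  move: ev; case/shortenP: p0P => p pP up _ ev.
  have uvp : is_path u v p.
    by split=> //; apply: sub_path pP => s t /andP[].
  have pA := cvA _ _ _ uA vA uvp.
  case: p pP up ev uvp pA => [|w p] /= pP up ev uvp pA.
    have := cards2 x y; rewrite xy euv ev setUid cards1; lia.
  case/andP: pP => /andP[uw /negP[]]; rewrite exy.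
  have wA : w \in A by apply: pA; rewrite !inE eqxx orbT.
  by have [-> _] := abE u w (Aab u uA) (Aab w wA) (adj_neq uw).
pose e := [set a; b]; exists [set e]; split=> [E|x y xA yA].
  rewrite inE => /eqP->; apply/subsetP => z; rewrite in_set2 => zab.
  by apply: Asub; rewrite !inE.
have [->|xy] := eqVneq x y; first exact: nilA.
have conn s t : s \in A -> t \in A -> _ := @path_convex_conn A s t G_conn cvA.
split; last first.
  left; have [p [pP pA ep]] := path_thru_edge aA bA ab conn A2 xA yA xy.
  exists p; split=> //; case: pP => _ up _.
  rewrite /count_red (eq_count (a2 := pred1 e)); last by move=> E; rewrite /= inE.
  by rewrite count_uniq_mem ?path_edges_uniq // ep.
pose D := [rel u w | in_rel A u w && ([set u; w] != e)].
(* Deleting an end [w] of [e] removes [e] as well. *)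
have conD w s t : w \in e -> s \in A -> t \in A -> s != w -> t != w -> connect D s t.
  move=> we sA tA sw tw; have wA : w \in A.
    by move: we; rewrite in_set2 => /orP[]/eqP->.
  have [p [sp _ <-] pA] := A2 w s t wA sA tA sw tw.
  apply/connectP; exists p => //; apply: (sub_in_path (P := mem (A :\ w)) _ _ sp).
    move=> u z; rewrite !inE => /andP[uw uA] /andP[zw zA] uz; rewrite /= uz uA zA /=.
    by apply: contraTneq we => <-; rewrite in_set2 negb_or eq_sym uw eq_sym zw.
  by apply/allP => z /pA.
have [ae be] : a \in e /\ b \in e by rewrite set21 set22.
(* Deleting [a] suffices unless [x] or [y] is [a]. In that case the route goes via [c], and [b] is
   deleted for the part between [a] and [c]. *)
have cxy : connect D x y.
  have [xa|xa] := eqVneq x a.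
    have ya : y != a by rewrite -xa eq_sym.
    apply: (connect_trans (y := c)); last exact: (conD a _ _ ae).
    by apply: (conD b _ _ be); rewrite // xa adj_neq.
  have [ya|ya] := eqVneq y a; last exact: (conD a _ _ ae).
  apply: (connect_trans (y := c)); first exact: (conD a _ _ ae).
  by apply: (conD b _ _ be); rewrite // ya adj_neq.
case/connectP: cxy => p0 p0P ly; move: ly; case/shortenP: p0P => p pP up _ ly.
have pP' : is_path x y p.
  by split=> //; apply: sub_path pP => u z /andP[/and3P[]].
exists p; split=> //; first exact: cvA pP'.
apply/eqP; rewrite -leqn0 leqNgt -has_count; apply/hasPn => E Ep; rewrite /= inE.
elim: p x pP Ep {xA xy up ly pP'} => //= z p IHp x /andP[/andP[_ xz] zp].
by rewrite inE => /orP[/eqP->//|]; apply: IHp.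
Qed.

(** Induction on the size of [A]. If a vertex [v] separates [A], the two sides with [v] added are
    smaller and convex, and their colourings are glued at [v]; otherwise [block_coloring_2connected]
    applies. *)
Lemma block_coloring A : connected G -> path_convex A ->
  exists R, (forall E, E \in R -> E \subset A) /\
            {in A &, forall x y, block_colored A R x y}.
Proof.
move=> G_conn; have [m] := ubnP #|A|; elim: m A => // m IHm A /ltnSE leAm cvA.
have [/existsP[v /andP[vA /existsP[x /existsP[y]]]]|] := boolP
  [exists v, (v \in A) && [exists x, exists y, [&& x \in A :\ v, y \in A :\ v &
     ~~ connect (in_rel (A :\ v)) x y]]]; last first.
  move=> nocut; apply: block_coloring_2connected => // v x y vA xA yA xv yv.
  apply: connect_in_path; first by rewrite !inE xv.
  apply: contraR nocut => ncxy; apply/existsP; exists v; rewrite vA /=.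
  by apply/existsP; exists x; apply/existsP; exists y; rewrite !inE xv yv xA yA.
case/and3P=> xAv yAv nxy.
(* [B] is one component of [A] minus [v], and [C] gathers all the others. *)
pose B := [set z in A :\ v | connect (in_rel (A :\ v)) x z].
pose C := (A :\ v) :\: B.
have sBA : B \subset A :\ v by apply/subsetP => z; rewrite inE => /andP[].
have defA : A = v |: (B :|: C).
  by rewrite -{1}(setD1K vA) -{1}(setID (A :\ v) B) (setIidPr sBA).
have vB : v \notin B by rewrite !inE eqxx.
have vC : v \notin C by rewrite !inE eqxx andbF.
have dBC : [disjoint B & C].
  by rewrite -setI_eq0 /C setIDA setIC -setIDA setDv setI0.
have nBC u w : u \in B -> w \in C -> ~~ adj u w.
  rewrite [u \in B]inE => /andP[uA xu]; rewrite inE => /andP[wB wA].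
  apply: contraNN wB => uw; rewrite inE wA.
  by apply: connect_trans xu (connect1 _); rewrite /= uw uA.
have nCB u w : u \in C -> w \in B -> ~~ adj u w.
  by move=> uC wB; rewrite adj_sym nBC.
have dCB : [disjoint C & B] by rewrite disjoint_sym.
have cv1 : path_convex (v |: B) by apply: path_convex_cut dBC vC nBC _; rewrite -defA.
have cv2 : path_convex (v |: C).
  by apply: path_convex_cut dCB vB nCB _; rewrite (setUC C) -defA.
have xB : x \in B by rewrite inE xAv connect0.
have yC : y \in C by rewrite inE yAv inE yAv (negPf nxy).
have card_lt z D : z \in A -> z \notin v |: D -> v |: D \subset A -> #|v |: D| < m.
  move=> zA zD DA; apply: leq_trans leAm; apply: proper_card.
  by apply/properP; split=> //; exists z.
have sAB : v |: B \subset A by rewrite defA setUS // subsetUl.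
have sAC : v |: C \subset A by rewrite defA setUS // subsetUr.
have [xv xA] : x != v /\ x \in A by move: xAv; rewrite !inE => /andP[].
have [yv yA] : y != v /\ y \in A by move: yAv; rewrite !inE => /andP[].
have xC := disjointFr dBC xB; have yB := disjointFr dCB yC.
have [R1 [R1B h1]] : exists R, (forall E, E \in R -> E \subset v |: B) /\
    {in v |: B &, forall x y, block_colored (v |: B) R x y}.
  by apply: IHm cv1; apply: card_lt yA _ sAB; rewrite in_setU1 negb_or yv yB.
have [R2 [R2C h2]] : exists R, (forall E, E \in R -> E \subset v |: C) /\
    {in v |: C &, forall x y, block_colored (v |: C) R x y}.
  by apply: IHm cv2; apply: card_lt xA _ sAC; rewrite in_setU1 negb_or xv xC.
have IBC : (v |: B) :&: (v |: C) = [set v].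
  by rewrite -setUIr (eqP (_ : B :&: C == set0)) ?setI_eq0 // setU0.
have ICB : (v |: C) :&: (v |: B) = [set v] by rewrite setIC.
have UBC : (v |: B) :|: (v |: C) = A by rewrite setUACA setUid -defA.
have UCB : (v |: C) :|: (v |: B) = A by rewrite setUC.
pose R := R1 :|: R2.
have {}h1 : {in v |: B &, forall x y, block_colored (v |: B) R x y}.
  move=> s t sB tB; apply: block_colored_recolor R2C (h1 _ _ sB tB); rewrite IBC //.
have {}h2 : {in v |: C &, forall x y, block_colored (v |: C) R x y}.
  move=> s t sB tB; rewrite /R (setUC R1).
  by apply: block_colored_recolor R1B (h2 _ _ sB tB); rewrite ICB.
exists R; split=> [E|s t].
  rewrite inE => /orP[/R1B|/R2C] /subset_trans; exact.
have [vB' vC'] : v \in v |: B /\ v \in v |: C by rewrite !setU11.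
rewrite -{1 2}UBC !(in_setU _ (v |: B)) => /orP[]sB /orP[]tB.
- exact: block_colored_sub sAB (h1 _ _ sB tB).
- by rewrite -UBC; apply: block_colored_cat IBC (h1 _ _ sB vB') (h2 _ _ vC' tB).
- by rewrite -UCB; apply: block_colored_cat ICB (h2 _ _ sB vC') (h1 _ _ vB' tB).
- exact: block_colored_sub sAC (h2 _ _ sB tB).
Qed.

End Blocks.

(** * Few cut-edges *)

Section CutEdges.
Variable G : sgraph.
Implicit Types (x y z u v w : G) (E K : {set G}).

Lemma edgesP E : reflect (exists u v, adj u v /\ E = [set u; v]) (E \in edges G).
Proof.
apply: (iffP imsetP) => [[[u v]]|[u [v [uv ->]]]].
  by rewrite inE /= => uv ->; exists u, v.
by exists (u, v); rewrite ?inE.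
Qed.

(** If the ends of [E] stay connected, a detour replaces [E] everywhere and one component remains;
    otherwise the ends represent two components. *)
Lemma cut_edgeP E : connected G ->
  (E \in cut_edges G) <-> (E \in edges G /\ bridge E).
Proof.
move=> G_conn; rewrite inE; split=> [/andP[Ee lt]|[Ee brE]]; [split=> //|].
  move=> u v eE; apply: contraL lt => cuv; rewrite -leqNgt.
  rewrite /num_components (@eq_n_comp _ (@adj (del_edge E)) (@adj G)) // => x y.
  rewrite G_conn; have /connectP[p xp ->] := G_conn x y.
  elim: p x xp => [|z p IHp] x /= => [_|/andP[xz zp]]; first exact: connect0.
  apply: connect_trans (IHp _ zp).
  have [e|ne] := eqVneq [set x; z] E; last by apply: connect1; rewrite /= xz ne.
  have := set21 x z; have := set22 x z; rewrite e eE !in_set2.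
  move=> /orP[]/eqP-> /orP[]/eqP->; rewrite ?connect0 //= -?eE //.
  by rewrite connect_del_sym.
rewrite Ee /=; have /edgesP[u [v [uv eE]]] := Ee.
have n1 : num_components G = 1.
  rewrite /num_components -(n_comp_connect (sym_connect_sym (@adj_sym G)) u).
  by apply: eq_n_comp_r => x; rewrite !inE; rewrite [RHS]G_conn.
have dsym := @connect_del_sym G E.
rewrite n1 /num_components /n_comp_mem.
apply/card_gt1P; exists (fingraph.root (del_rel E) u), (fingraph.root (del_rel E) v).
split; rewrite ?inE ?andbT; try exact: (roots_root dsym).
by apply: contraNneq (brE u v eE) => e; rewrite -(root_connect dsym); apply/eqP.
Qed.

Definition del_edges (s : seq {set G}) :=
  [rel u v | adj u v && ([set u; v] \notin s)].

Lemma connect_del_edges_sym s : connect_sym (del_edges s).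
Proof. by apply: sym_connect_sym => u v; rewrite /= adj_sym setUC. Qed.

(** Induction on [s]: deleting one more bridge separates its ends [u] and [v], so at least one of
    them is out of reach of all members of [T] and can be added to [T]. *)
Lemma bridges_components s : #|G| > 0 -> uniq s ->
  (forall E, E \in s -> E \in edges G /\ bridge E) ->
  exists2 T : {set G}, #|T| = (size s).+1 &
    {in T &, forall t u, connect (del_edges s) t u -> t = u}.
Proof.
move=> /card_gt0P[x0 _]; elim: s => [|E s IHs] /= => [_ _|/andP[Es us] brs].
  by exists [set x0]; rewrite ?cards1 // => t u; rewrite !inE => /eqP-> /eqP->.
have [|T cT hT] := IHs us; first by move=> E' E's; apply: brs; rewrite inE E's orbT.
have [|/edgesP[u [v [uv eE]]] brE] := brs E; first by rewrite inE eqxx.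
have csym := connect_del_edges_sym.
have sub1 : subrel (connect (del_edges (E :: s))) (connect (del_edges s)).
  apply: connect_sub => a b /andP[ab]; rewrite inE negb_or => /andP[_ nab].
  by apply: connect1; rewrite /= ab.
have sub2 : subrel (connect (del_edges (E :: s))) (connect (del_rel E)).
  apply: connect_sub => a b /andP[ab]; rewrite inE negb_or => /andP[nab _].
  by apply: connect1; rewrite /= ab.
have cuv : connect (del_edges s) u v by apply: connect1; rewrite /= uv -eE.
suff [w wT] : exists w, forall t, t \in T -> ~~ connect (del_edges (E :: s)) t w.
  exists (w |: T).
    by rewrite cardsU1 cT; case: (boolP (w \in T)) => // /wT; rewrite connect0.
  move=> a b; rewrite !in_setU1 => /orP[/eqP->|aT] /orP[/eqP->|bT] //.
  - by rewrite csym (negPf (wT _ bT)).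
  - by rewrite (negPf (wT _ aT)).
  - by move=> /sub1; apply: hT.
(* [T] need not meet every component: if it misses that of [u], then [u] itself is new. *)
have [/existsP[t /andP[tT tu]]|nex] :=
    boolP [exists t, (t \in T) && connect (del_edges s) t u]; last first.
  exists u => t tT; apply: contraNN nex => /sub1 tu.
  by apply/existsP; exists t; rewrite tT.
(* Since [t] alone represents its old component, a vertex there that is cut off from [t] is cut off
   from all of [T]. *)
have only w : connect (del_edges s) t w -> ~~ connect (del_edges (E :: s)) t w ->
    forall t', t' \in T -> ~~ connect (del_edges (E :: s)) t' w.
  move=> tw ntw t' t'T; apply: contraNN ntw => t'w.
  rewrite -(hT t' t t'T tT) //; apply: connect_trans (sub1 _ _ t'w) _.
  by rewrite csym.
have [tu'|ntu] := boolP (connect (del_edges (E :: s)) t u); last by exists u; apply: only.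
exists v; apply: only; first exact: connect_trans cuv.
apply: contraNN (brE _ _ eE) => tv; apply: sub2; apply: connect_trans tv.
by rewrite csym.
Qed.

Lemma degree_ge_min x : min_degree G <= degree x.
Proof.
rewrite /min_degree; elim: (index_enum _) (mem_index_enum x) => //= y s IHs.
rewrite inE big_cons geq_min => /orP[/eqP->|/IHs->]; rewrite ?leqnn ?orbT //.
Qed.

(* Counting the ends in [K] of the deleted bridges: were every vertex of [K]
   incident with one of them, there would be at least [k * max 1 (6 - k)] such
   ends for [k = #|K|], whereas a bridge has at most one end in [K]. *)
Lemma component_card_gt s t : 4 < min_degree G -> uniq s -> size s = 4 ->
  (forall E, E \in s -> E \in edges G /\ bridge E) ->
  min_degree G < #|[set z | connect (del_edges s) t z]|.
Proof.
move=> deg5 us s4 brs; set K := [set z | _].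
pose f z := #|[set E in [set E in s] | z \in E]|.
(* A neighbour of [z] lies in [K] unless the edge leading to it was deleted. *)
have degK z : z \in K -> degree z <= #|K|.-1 + f z.
  move=> zK; have := cardsD1 z K; rewrite zK add1n => -> /=.
  pose W := [set w | adj z w && ([set z; w] \in s)].
  apply: (@leq_trans #|(K :\ z) :|: W|).
    apply: subset_leq_card; apply/subsetP => w; rewrite inE => zw.
    rewrite in_setU [w \in W]inE zw /=; case: (boolP (_ \in s)) => zws.
      by rewrite orbT.
    rewrite !inE eq_sym adj_neq //= orbF; move: zK; rewrite inE => tz.
    by apply: connect_trans tz (connect1 _); rewrite /= zw.
  apply: leq_trans (leq_card_setU _ _) _; rewrite leq_add2l.
  have injW : {in W &, injective (fun w => [set z; w])}.
    move=> a b; rewrite !inE => /andP[za _] /andP[zb _] e.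
    have := set22 z a; rewrite e in_set2 => /orP[/eqP az|/eqP//].
    by move: za; rewrite az adj_irr.
  rewrite -(card_in_imset injW); apply: subset_leq_card.
  apply/subsetP => E /imsetP[w wW ->]; move: wW; rewrite [w \in W]inE => /andP[_ ws].
  by rewrite !inE ws eqxx.
have sumf : \sum_(z in K) f z <= 4.
  rewrite /f sum_card_swap -s4 -(card_uniqP us) -(cardsE (mem s)) -sum1_card.
  apply: leq_sum => E; rewrite inE => Es.
  have [/edgesP[u [v [uv eE]]] brE] := brs E Es.
  rewrite leqNgt; apply/negP => /card_gt1P[a [b [aK bK ab]]].
  move: aK bK; rewrite !inE => /andP[ta aE] /andP[tb bE].
  have cab : connect (del_edges s) a b.
    by apply: connect_trans tb; rewrite connect_del_edges_sym.
  have e : E = [set a; b].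
    apply/eqP; rewrite eq_sym eqEcard cards2 ab eE cards2 adj_neq //= andbT.
    by apply/subsetP => c; rewrite -eE in_set2 => /orP[]/eqP->.
  have /negP[] := brE _ _ e; apply: connect_sub cab => c d /andP[cd nd].
  by apply: connect1; rewrite /= cd; apply: contraNneq nd => ->.
have tK : t \in K by rewrite inE connect0.
have [/existsP[z /andP[zK /eqP fz]]|noz] := boolP [exists z, (z \in K) && (f z == 0)].
  have := degK z zK; have := degree_ge_min z; rewrite fz addn0.
  have : 0 < #|K| by apply/card_gt0P; exists t.
  lia.
have f1 z : z \in K -> 0 < f z.
  move=> zK; rewrite lt0n; apply: contraNN noz => fz; apply/existsP; exists z.
  by rewrite zK.
have K0 : 0 < #|K| by apply/card_gt0P; exists t.
have c1 : #|K| <= 4.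
  by apply: leq_trans sumf; rewrite -sum1_card; apply: leq_sum.
(* Degree at least 5 forces [f z] to be at least [5 - (#|K| - 1)]. For [#|K|] from 1 to 4 the
   product is at least 5, a contradiction. *)
have c2 : #|K| * (6 - #|K|) <= 4.
  apply: leq_trans sumf; rewrite -sum_nat_const; apply: leq_sum => z zK.
  have := degK z zK; have := degree_ge_min z; lia.
by move: K0 c1 c2; case: #|K| => [|[|[|[|[|k]]]]].
Qed.

(** Four bridges would leave five disjoint components, needing at least [5 * (min_degree G + 1)]
    vertices, one more than the bound allows. *)
Lemma card_cut_edges : connected G -> 4 < min_degree G ->
  #|G| <= 5 * min_degree G + 4 -> #|cut_edges G| <= 3.
Proof.
move=> G_conn deg5 nle; rewrite leqNgt; apply/negP => c4.
pose s := take 4 (enum (cut_edges G)).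
have s4 : size s = 4 by rewrite size_takel // -cardE.
have us : uniq s by rewrite take_uniq ?enum_uniq.
have brs E : E \in s -> E \in edges G /\ bridge E.
  by move=> /mem_take; rewrite mem_enum => /(cut_edgeP _ G_conn).
have G0 : 0 < #|G|.
  have [x _] : exists x : G, true.
    case: s s4 brs {us} => // E s _ /(_ E) []; first by rewrite inE eqxx.
    by move=> /edgesP[u]; exists u.
  by apply/card_gt0P; exists x.
have [T cT hT] := bridges_components G0 us brs.
have : \sum_(t in T) #|[set z in [set: G] | connect (del_edges s) t z]| <= #|G|.
  rewrite sum_card_swap -cardsT -sum1_card; apply: leq_sum => z _.
  rewrite leqNgt; apply/negP => /card_gt1P[a [b [aT bT /eqP[]]]].
  move: aT bT; rewrite !inE => /andP[aT az] /andP[bT bz]; apply: hT => //.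
  by apply: connect_trans az _; rewrite connect_del_edges_sym.
have : \sum_(t in T) (min_degree G).+1 <=
       \sum_(t in T) #|[set z in [set: G] | connect (del_edges s) t z]|.
  apply: leq_sum => t _.
  apply: leq_trans (component_card_gt t deg5 us s4 brs) _.
  by apply: subset_leq_card; apply/subsetP => z; rewrite !inE.
rewrite sum_nat_const cT s4; lia.
Qed.

End CutEdges.

(** * Two colours suffice *)

Section Coloring.
Variable G : sgraph.
Implicit Types (x y z u v w : G) (E r : {set G}) (R : {set {set G}}).

Lemma edge_at E x : E \in edges G -> x \in E ->
  exists2 y, adj x y & E = [set x; y].
Proof.
move=> /edgesP[u [v [uv ->]]]; rewrite in_set2 => /orP[]/eqP->; first by exists v.
by exists u; [rewrite adj_sym | rewrite setUC].
Qed.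

Lemma edge_adj x y : [set x; y] \in edges G -> adj x y.
Proof.
move=> /edge_at/(_ (set21 x y))[z xz e]; have := set22 x z.
rewrite -e in_set2 => /orP[]/eqP ez; last by rewrite -ez.
by rewrite ez adj_irr in xz.
Qed.

Lemma cut_edge_edges E : E \in cut_edges G -> E \in edges G.
Proof. by rewrite inE => /andP[]. Qed.

(** In the list of its path component, the neighbours of [x] can occupy only the two positions next
    to that of [x]. *)
Lemma linear_forest_no_claw x y1 y2 y3 : linear_forest (cut_subgraph G) ->
  [set x; y1] \in cut_edges G -> [set x; y2] \in cut_edges G ->
  [set x; y3] \in cut_edges G -> [|| y1 == y2, y1 == y3 | y2 == y3].
Proof.
move=> [_ comp] c1 c2 c3.
have covx : x \in cover (cut_edges G).
  by apply/bigcupP; exists [set x; y1]; rewrite ?set21.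
pose x' : cut_subgraph G := exist _ x covx.
have [s [us sx adjs]] := comp x'.
have nbr y : [set x; y] \in cut_edges G -> exists2 i,
    (i == (index x' s).+1) || (index x' s == i.+1) & y = val (nth x' s i).
  move=> cxy; have covy : y \in cover (cut_edges G).
    by apply/bigcupP; exists [set x; y]; rewrite ?set22.
  pose y' : cut_subgraph G := exist _ y covy.
  have xy : adj x' y'.
    by rewrite /= /einduced_rel /= cxy (edge_adj (cut_edge_edges cxy)).
  have xs : x' \in s by rewrite sx; apply: connect0.
  have ys : y' \in s by rewrite sx; apply: connect1.
  by exists (index y' s); rewrite ?nth_index // -adjs.
have [i1 h1 ->] := nbr _ c1; have [i2 h2 ->] := nbr _ c2.
have [i3 h3 ->] := nbr _ c3.
have : [|| i1 == i2, i1 == i3 | i2 == i3] by lia.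
by case/or3P=> /eqP->; rewrite eqxx ?orbT.
Qed.

(** The other two sides of a triangle bypass the side [xy], which is then no bridge. *)
Lemma cut_edges_no_triangle x y z : connected G -> y != z ->
  [set x; y] \in cut_edges G -> [set x; z] \in cut_edges G ->
  [set y; z] \notin cut_edges G.
Proof.
move=> G_conn yz cxy cxz; apply/negP => cyz.
have [xy xz zy] : [/\ adj x y, adj x z & adj z y].
  by rewrite (adj_sym z); split; apply: edge_adj; apply: cut_edge_edges.
have /(cut_edgeP _ G_conn)[_ br] := cxy.
have P1 : is_path x y [:: z; y].
  by split; rewrite /= ?xz ?zy // !inE negb_or !adj_neq.
suff nxy : [set x; y] \notin path_edges x [:: z; y].
  by have := bridge_avoid br P1 (is_path_edge xy) nxy; rewrite inE eqxx.
rewrite /= !inE negb_or; apply/andP; split; apply/eqP => e.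
  have := set22 x y; rewrite e in_set2 (negPf yz) orbF eq_sym.
  by rewrite (negPf (adj_neq xy)).
have := set21 x y; rewrite e in_set2 (negPf (adj_neq xy)).
by rewrite (negPf (adj_neq xz)).
Qed.

(** Three pairwise intersecting edges form a star, excluded by [linear_forest_no_claw], or a
    triangle, excluded by [cut_edges_no_triangle]. *)
Lemma cut_edges_no_triple E1 E2 E3 : connected G ->
  linear_forest (cut_subgraph G) -> E1 \in cut_edges G -> E2 \in cut_edges G ->
  E3 \in cut_edges G -> E1 != E2 -> E1 != E3 -> E2 != E3 ->
  [|| [disjoint E1 & E2], [disjoint E1 & E3] | [disjoint E2 & E3]].
Proof.
move=> G_conn lin c1 c2 c3 n12 n13 n23; apply: contraT.
rewrite !negb_or -!setI_eq0 => /and3P[/set0Pn[x]] + /set0Pn[y] + /set0Pn[z].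
rewrite !in_setI => /andP[x1 x2] /andP[y1 y3] /andP[z2 z3].
have [a xa e1] := edge_at (cut_edge_edges c1) x1.
have [b xb e2] := edge_at (cut_edge_edges c2) x2.
have ab : a != b by apply: contraNneq n12 => ab; rewrite e1 e2 ab.
have [x3|x3] := boolP (x \in E3).
  have [c xc e3] := edge_at (cut_edge_edges c3) x3; rewrite e1 e2 e3 in c1 c2 c3.
  have := linear_forest_no_claw lin c1 c2 c3; rewrite (negPf ab) /=.
  by case/orP=> /eqP e; move: n13 n23; rewrite e1 e2 e3 e eqxx.
have a3 : a \in E3.
  by move: y1 y3; rewrite e1 in_set2 => /orP[]/eqP->; rewrite ?(negPf x3).
have b3 : b \in E3.
  by move: z2 z3; rewrite e2 in_set2 => /orP[]/eqP->; rewrite ?(negPf x3).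
have [c ac e3] := edge_at (cut_edge_edges c3) a3.
have ebc : b = c by move: b3; rewrite e3 in_set2 eq_sym (negPf ab) => /eqP.
rewrite e1 e2 e3 -ebc in c1 c2 c3.
by have := cut_edges_no_triangle G_conn ab c1 c2; rewrite c3.
Qed.

(** Of three cut-edges two are disjoint, and [r] is the third. With one or two cut-edges, any of
    them can be [r]. *)
Lemma cut_edges_matching_but_one : connected G ->
  linear_forest (cut_subgraph G) -> #|cut_edges G| <= 3 ->
  exists2 r, bridge r & {in cut_edges G &, forall E E',
    E != r -> E' != r -> E != E' -> [disjoint E & E']}.
Proof.
move=> G_conn lin; rewrite cardE.
have : {subset enum (cut_edges G) <= cut_edges G} by move=> E; rewrite mem_enum.
have : {subset cut_edges G <= enum (cut_edges G)} by move=> E; rewrite mem_enum.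
have := enum_uniq (cut_edges G).
have br E : E \in cut_edges G -> bridge E by move=> /(cut_edgeP _ G_conn)[].
case: (enum _) => [|e1 [|e2 [|e3 [|? s]]]] //= us sub sub' _.
- exists set0 => [u v e|E E' /sub//].
  by have := set21 u v; rewrite -e inE.
- exists e1; first by apply: br; apply: sub'; rewrite inE eqxx.
  by move=> E E' /sub; rewrite !inE => ->.
- exists e1; first by apply: br; apply: sub'; rewrite inE eqxx.
  move=> E E' /sub + /sub; rewrite !inE.
  by move=> /orP[/eqP->|/eqP->] /orP[/eqP->|/eqP->]; rewrite ?eqxx.
have [c1 c2 c3] : [/\ e1 \in cut_edges G, e2 \in cut_edges G & e3 \in cut_edges G].
  by split; apply: sub'; rewrite !inE eqxx ?orbT.
move: us; rewrite !inE negb_or andbT => /andP[/andP[n12 n13] n23].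
have mem3 E : E \in cut_edges G -> [|| E == e1, E == e2 | E == e3].
  by move=> /sub; rewrite !inE.
case/or3P: (cut_edges_no_triple G_conn lin c1 c2 c3 n12 n13 n23) => dis.
- exists e3; first exact: br.
  move=> E E' /mem3/or3P[]/eqP-> /mem3/or3P[]/eqP->; rewrite ?eqxx // => _ _ _.
  by rewrite disjoint_sym.
- exists e2; first exact: br.
  move=> E E' /mem3/or3P[]/eqP-> /mem3/or3P[]/eqP->; rewrite ?eqxx // => _ _ _.
  by rewrite disjoint_sym.
- exists e1; first exact: br.
  move=> E E' /mem3/or3P[]/eqP-> /mem3/or3P[]/eqP->; rewrite ?eqxx // => _ _ _.
  by rewrite disjoint_sym.
Qed.

Definition red R E : nat := E \in R.

Lemma conflict_free_one_red R x p :
  count_red R (path_edges x p) = 1 -> conflict_free_path (red R) x p.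
Proof.
move=> one; exists 1; rewrite -[RHS]one count_map; apply: eq_count => E /=.
by rewrite /red; case: (E \in R).
Qed.

Lemma cfc_coloring_red R r : bridge r -> connected G ->
  {in cut_edges G &, forall E E',
    E != r -> E' != r -> E != E' -> [disjoint E & E']} ->
  (forall x y, block_colored setT R x y) -> cfc_coloring (red (r |: R)).
Proof.
move=> br G_conn matching blk x y xy.
have [[p [pP _ p0]] others] := blk x y.
have red0 q : r \notin path_edges x q ->
    count_red (r |: R) (path_edges x q) = count_red R (path_edges x q).
  move=> nr; apply: eq_in_count => E Eq; rewrite /= in_setU1.
  by case: eqP => // e; rewrite -e Eq in nr.
have [rp|rp] := boolP (r \in path_edges x p).
  exists p; split=> //; apply: conflict_free_one_red.
  have up : uniq (path_edges x p) by case: pP => _ /path_edges_uniq.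
  have := count_uniq_mem r up; rewrite rp => r1; rewrite -[RHS]r1.
  apply: eq_in_count => E Ep; rewrite /= in_setU1; case: eqP => //= _.
  apply: contraPF p0 => ER; apply/eqP; rewrite -lt0n -has_count.
  by apply/hasP; exists E.
have avoid q : is_path x y q -> r \notin path_edges x q.
  by move=> qP; apply: bridge_avoid br pP qP rp.
case: others => [[q [qP _ q1]]|[q [qP _ qbr]]]; exists q; split=> //.
  by apply: conflict_free_one_red; rewrite red0 ?avoid.
have cutq E : E \in path_edges x q -> E \in cut_edges G.
  move=> Eq; apply/(cut_edgeP _ G_conn); split; last exact: qbr.
  case: qP => xq _ _; have [u [v [uv -> _ _]]] := path_edgesP xq Eq.
  by apply/edgesP; exists u, v.
have nr := avoid _ qP.
case: q qP cutq nr {qbr} => [[_ _ /eqP]|a [|b q]]; first by rewrite (negPf xy).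
  (* On a path with a single edge, the colour of that edge occurs once, whichever it is. *)
  by move=> _ _ _; exists (red (r |: R) [set x; a]); rewrite /= eqxx.
(* Two consecutive edges would be distinct cut-edges other than [r] sharing the vertex [a], against
   [matching]. *)
move=> [_ uq _] cutq; rewrite /= !inE !negb_or => /and3P[n1 n2 _].
have := matching [set x; a] [set a; b].
rewrite !cutq ?inE ?eqxx ?orbT // => /(_ isT isT).
rewrite eq_sym n1 eq_sym n2 => /(_ isT isT) dis.
have /dis : [set x; a] != [set a; b].
  by have := path_edges_uniq uq; rewrite /= inE negb_or => /andP[/andP[]].
by move=> /pred0P/(_ a); rewrite /= !inE eqxx orbT.
Qed.

(** A path between two non-adjacent vertices has at least two edges, so a colour occurring once on
    it is accompanied by another one. *)
Lemma cfc_coloring_num_colors_ge (c : {set G} -> nat) :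
  ~ complete G -> cfc_coloring c -> 1 < num_colors c.
Proof.
move=> ncomp cfc.
have [/existsP[x /existsP[y /andP[xy nxy]]]|nex] :=
    boolP [exists x : G, exists y : G, (x != y) && ~~ adj x y]; last first.
  case: ncomp => x y xy; apply: contraNT nex => nxy.
  by apply/existsP; exists x; apply/existsP; exists y; rewrite xy.
have [p [[xp up lp] [k kp]]] := cfc x y xy.
pose cs := [seq c E | E <- path_edges x p].
have cs_sub : {subset cs <= [seq c E | E in edges G]}.
  move=> _ /mapP[E Ep ->]; apply: map_f; rewrite mem_enum; apply/edgesP.
  by have [u [v [uv -> _ _]]] := path_edgesP xp Ep; exists u, v.
have sz : 1 < size cs.
  rewrite size_map size_path_edges; case: p xp lp {up kp cs cs_sub} => [|z [|]] //=.
    by move=> _ e; rewrite e eqxx in xy.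
  by move=> /andP[xz _] e; rewrite -e xz in nxy.
have kcs : k \in cs by rewrite -has_pred1 has_count kp.
have [l lcs lk] : exists2 l, l \in cs & l != k.
  apply/hasP; apply: contraLR sz => /hasPn all_k; rewrite -leqNgt -kp.
  rewrite -(count_predT cs); apply: eq_leq.
  by apply: eq_in_count => l /all_k; rewrite negbK /= => ->.
apply: (@uniq_leq_size _ [:: k; l]); first by rewrite /= inE eq_sym lk.
by move=> i; rewrite mem_undup !inE => /orP[]/eqP->; apply: cs_sub.
Qed.

Lemma num_colors_red R : num_colors (red R) <= 2.
Proof.
apply: (@uniq_leq_size _ _ [:: 0; 1]); first exact: undup_uniq.
by move=> i; rewrite mem_undup => /mapP[E _ ->]; rewrite /red; case: (E \in R).
Qed.

End Coloring.

Theorem theorem4p1 (G : sgraph) (n : nat)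
  (hn : #|G| = n) (n_ge25 : 25 <= n)
  (G_conn : connected G) (G_ncomp : ~ complete G)
  (C_lin : linear_forest (cut_subgraph G))
  (delta_ge : ((n%:R - 4%:R) / 5%:R <= (min_degree G)%:R :> rat)%R) :
  cfc_number_is G 2.
Proof.
have n_le : n <= 5 * min_degree G + 4.
  rewrite Num.Theory.ler_pdivrMr // in delta_ge.
  rewrite Num.Theory.lerBlDr -GRing.natrM -GRing.natrD Num.Theory.ler_nat in delta_ge.
  by rewrite mulnC.
split=> [|c cfc]; last exact: cfc_coloring_num_colors_ge.
(* From [25 <= n] and [n_le], five times the minimum degree is at least 21, so the minimum degree is
   at least 5. *)
have cut3 : #|cut_edges G| <= 3 by apply: card_cut_edges => //; lia.
have [r br matching] := cut_edges_matching_but_one G_conn C_lin cut3.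
have cvT : path_convex [set: G] by move=> x y p _ _ _ z _; rewrite inE.
have [R [_ blk]] := block_coloring G_conn cvT.
have cfc : cfc_coloring (red (r |: R)).
  by apply: cfc_coloring_red => // x y; apply: blk; rewrite inE.
exists (red (r |: R)); split=> //; apply/eqP.
by rewrite eqn_leq num_colors_red cfc_coloring_num_colors_ge.
Qed.
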